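(* Let the tensor $C(y_1)=(C_{ijkl}(y_1))$ satisfy the symmetry and positivity conditions $$C_{ijkl}(y_1)=C_{jikl}(y_1)=C_{ijlk}(y_1)=C_{klij}(y_1),\qquad C_{ijkl}\xi_{ij}\xi_{kl}\ge A|\xi_{mn}|^2\ \text{ for any }\xi=(\xi_{ij}),\quad A>0.$$ Then the tensor $$\overline C=\langle C(y_1)\rangle-\langle C_1(y_1)\mathcal C^{-1}(y_1)C^1(y_1)\rangle+\langle C_1(y_1)\mathcal C^{-1}(y_1)\rangle\langle\mathcal C^{-1}(y_1)\rangle^{-1}\langle\mathcal C^{-1}(y_1)C^1(y_1)\rangle$$ is positive-definite and satisfies the minor and major symmetry conditions $\overline C_{ijkl}=\overline C_{jikl}=\overline C_{ijlk}=\overline C_{klij}$.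
   Context: All indices run over $\{1,2\}$ and repeated indices are summed. $C_{ijkl}(y_1)$ is an $l_1$-periodic tensor function of $y_1$ ($l_1>0$), equal to $C^A(y_1)$ on $[0,\gamma l_1]$ and $C^B(y_1)$ on $[\gamma l_1,l_1]$ for some $\gamma\in(0,1)$. Notation: $\langle f\rangle=\frac1{l_1}\int_0^{l_1}f(y_1)\,dy_1$ (entrywise); $(C^1)_{ikl}=C_{i1kl}$; $(C_1)_{ijk}=C_{ijk1}$; $\mathcal C$ is the symmetric $2\times2$ matrix $\mathcal C_{ik}=C_{i1k1}$. Products contract adjacent indices: $(C_1\mathcal C^{-1}C^1)_{ijkl}=(C_1)_{ijm}(\mathcal C^{-1})_{mp}(C^1)_{pkl}$, $(C_1\mathcal C^{-1})_{ijp}=(C_1)_{ijm}(\mathcal C^{-1})_{mp}$, $(\mathcal C^{-1}C^1)_{qkl}=(\mathcal C^{-1})_{qr}(C^1)_{rkl}$; $\langle\mathcal C^{-1}\rangle^{-1}$ is the inverse of the matrix $\langle\mathcal C^{-1}\rangle$. Positive-definiteness of $\overline C$ means $\overline C_{ijkl}\xi_{ij}\xi_{kl}\ge A|\xi_{mn}|^2>0$ (for $\xi\neq 0$), with $A$ the constant in the condition on $C$.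
   Formalization: Positivity of C and of the homogenized tensor is taken over symmetric ξ only, since for skew ξ the minor symmetry makes C_ijkl ξ_ij ξ_kl = 0 and the condition ''for any ξ'' impossible; the entries of C are assumed integrable on [0,l_1]. *)

(* Defs.v *)
From HB Require Import structures.
From mathcomp Require Import all_boot all_order all_algebra.
From mathcomp Require Import all_classical all_reals all_analysis.

Set Implicit Arguments.
Unset Strict Implicit.
Unset Printing Implicit Defensive.

Import Order.TTheory GRing.Theory Num.Theory.
Import numFieldNormedType.Exports.

Local Open Scope classical_set_scope.
Local Open Scope ring_scope.

(* Tensor indices in {1, 2} are encoded in 'I_2: [0] stands for 1. *)
Definition tensor3 (R : realType) := 'I_2 -> 'I_2 -> 'I_2 -> R.
Definition tensor4 (R : realType) := 'I_2 -> 'I_2 -> 'I_2 -> 'I_2 -> R.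

Definition elastic_symmetric (R : realType) (T : tensor4 R) : Prop :=
  forall i j k l : 'I_2,
    [/\ T i j k l = T j i k l, T i j k l = T i j l k & T i j k l = T k l i j].

Definition quad (R : realType) (T : tensor4 R) (xi : 'M[R]_2) : R :=
  \sum_(i < 2) \sum_(j < 2) \sum_(k < 2) \sum_(l < 2)
     T i j k l * xi i j * xi k l.

Definition sqnorm (R : realType) (xi : 'M[R]_2) : R :=
  \sum_(m < 2) \sum_(n < 2) xi m n ^+ 2.

(* xi ranges over symmetric (strain) tensors: T i j k l = T j i k l makes
   quad T vanish on skew-symmetric xi, so that no such T could satisfy the
   inequality for all 2x2 matrices with A > 0. *)
Definition coercive (R : realType) (A : R) (T : tensor4 R) : Prop :=
  forall xi : 'M[R]_2, xi^T = xi -> A * sqnorm xi <= quad T xi.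

Definition positive_definite (R : realType) (A : R) (T : tensor4 R) : Prop :=
  forall xi : 'M[R]_2, xi^T = xi -> xi != 0 ->
    0 < A * sqnorm xi <= quad T xi.

Definition avg (R : realType) (l1 : R) (f : R -> R) : R :=
  l1^-1 * \int[@lebesgue_measure R]_(y in `[0, l1]) f y.

Definition avg_mx (R : realType) (l1 : R) (M : R -> 'M[R]_2) : 'M[R]_2 :=
  \matrix_(i, j) avg l1 (fun y => M y i j).

Definition avg3 (R : realType) (l1 : R) (T : R -> tensor3 R) : tensor3 R :=
  fun i j k => avg l1 (fun y => T y i j k).

Definition avg4 (R : realType) (l1 : R) (T : R -> tensor4 R) : tensor4 R :=
  fun i j k l => avg l1 (fun y => T y i j k l).

(* sup1, sub1 and mat1 are usually written C^1, C_1 and calC in the theory of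
   laminates with layering direction 1. *)
Definition sup1 (R : realType) (T : tensor4 R) : tensor3 R :=
  fun i k l => T i 0 k l.

Definition sub1 (R : realType) (T : tensor4 R) : tensor3 R :=
  fun i j k => T i j k 0.

Definition mat1 (R : realType) (T : tensor4 R) : 'M[R]_2 :=
  \matrix_(i, k) T i 0 k 0.

Definition mul3m (R : realType) (U : tensor3 R) (M : 'M[R]_2) : tensor3 R :=
  fun i j p => \sum_(m < 2) U i j m * M m p.

Definition mulm3 (R : realType) (M : 'M[R]_2) (U : tensor3 R) : tensor3 R :=
  fun q k l => \sum_(r < 2) M q r * U r k l.

Definition mul33 (R : realType) (U V : tensor3 R) : tensor4 R :=
  fun i j k l => \sum_(p < 2) U i j p * V p k l.

(* <C> - <C_1 calC^-1 C^1> + <C_1 calC^-1> <calC^-1>^-1 <calC^-1 C^1>.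
   When C is coercive with A > 0 and has integrable entries, calC and
   <calC^-1> are invertible and every averaged entry is integrable, so no
   default value of invmx or of the integral is involved. *)
Definition homogenized (R : realType) (l1 : R) (C : R -> tensor4 R) :
    tensor4 R :=
  fun i j k l =>
    avg4 l1 C i j k l
    - avg4 l1 (fun y => mul33 (mul3m (sub1 (C y)) (invmx (mat1 (C y))))
                              (sup1 (C y))) i j k l
    + mul33 (mul3m (avg3 l1 (fun y => mul3m (sub1 (C y)) (invmx (mat1 (C y)))))
                   (invmx (avg_mx l1 (fun y => invmx (mat1 (C y))))))
            (avg3 l1 (fun y => mulm3 (invmx (mat1 (C y))) (sup1 (C y))))
        i j k l.

(* Main.v *)
(* For a symmetric strain xi put v = C^1 xi and N = calC^-1.  Adding to xi the
   strain of a displacement that varies only with y_1, with derivative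
   a = N (w - v), changes the energy pointwise by the exact amount
     C (xi + strain a) (xi + strain a) = C xi xi + w . N w - v . N v.
   With w = <N>^-1 <N v> the field a has mean zero and the average of the right
   hand side is the homogenized energy of xi, while coercivity and <a> = 0 bound
   the average of the left hand side below by A |xi|^2.
   All averages exist: coercivity gives |N_ij| <= 2 / A and v . N v <= C xi xi,
   so the entries of C_1 N C^1 are dominated by entries of C. *)
Require Import Defs.
From HB Require Import structures.
From mathcomp Require Import all_boot all_order all_algebra.
From mathcomp Require Import all_classical all_reals all_analysis.
From mathcomp Require Import measurable_realfun ring lra.

Set Implicit Arguments.
Unset Strict Implicit.
Unset Printing Implicit Defensive.

Import Order.TTheory GRing.Theory Num.Theory.
Import numFieldNormedType.Exports.

Local Open Scope classical_set_scope.
Local Open Scope ring_scope.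

(** * Two-valued indices and notation for forms and contractions *)

Lemma sum_ord2 (V : nmodType) (F : 'I_2 -> V) : \sum_(i < 2) F i = F 0 + F 1.
Proof.
by rewrite !big_ord_recl big_ord0 addr0; congr (_ + F _); apply: val_inj.
Qed.

Lemma ord2P (P : 'I_2 -> Prop) : P 0 -> P 1 -> forall i, P i.
Proof.
move=> P0 P1 [[|[|//]] hi].
  by rewrite (_ : Ordinal hi = 0) //; apply: val_inj.
by rewrite (_ : Ordinal hi = 1) //; apply: val_inj.
Qed.

Definition bil (R : realType) (M : 'M[R]_2) (u v : 'cV[R]_2) : R :=
  (u^T *m M *m v) 0 0.

Definition dot (R : realType) (u v : 'cV[R]_2) : R := (u^T *m v) 0 0.

Definition contract3 (R : realType) (U : tensor3 R) (xi : 'M[R]_2) : 'cV[R]_2 :=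
  \col_i \sum_(k < 2) \sum_(l < 2) U i k l * xi k l.

(** The traction of the strain [xi] on planes normal to [e_1]. *)
Definition contract (R : realType) (T : tensor4 R) (xi : 'M[R]_2) : 'cV[R]_2 :=
  contract3 (Defs.sup1 T) xi.

(* [U^T P U]: both [C_1 calC^-1 C^1] and the last term of [homogenized] have
   this shape, since major symmetry identifies [C_1] with the transpose of
   [C^1]. *)
Definition sandwich (R : realType) (U : tensor3 R) (P : 'M[R]_2) : tensor4 R :=
  mul33 (mul3m (fun i j p => U p i j) P) U.

(* The strain [(a (x) e_1 + e_1 (x) a) / 2] of the displacement [y_1 a]. *)
Definition strain (R : realType) (a : 'cV[R]_2) : 'M[R]_2 :=
  \matrix_(i, j) ((a i 0 *+ (j == 0) + a j 0 *+ (i == 0)) / 2).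

(** Coercivity speaks only of symmetric strains; by minor symmetry, pairing with these symmetrized
    units still extracts single entries. *)
Definition sym_unit (R : realType) (i j : 'I_2) : 'M[R]_2 :=
  2^-1 *: (delta_mx i j + delta_mx j i).

(** * Pointwise algebra of energies and strains *)

Section Algebra.
Variables (R : realType).
Implicit Types (T : tensor4 R) (xi : 'M[R]_2) (a u v w : 'cV[R]_2).

Lemma bilE (M : 'M[R]_2) u v :
  bil M u v = \sum_(i < 2) \sum_(j < 2) u i 0 * M i j * v j 0.
Proof.
rewrite /bil mxE exchange_big; apply: eq_bigr => j _.
by rewrite mxE mulr_suml; apply: eq_bigr => i _; rewrite mxE.
Qed.

Lemma dotE u v : dot u v = \sum_(i < 2) u i 0 * v i 0.
Proof. by rewrite /dot mxE; apply: eq_bigr => i _; rewrite mxE. Qed.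

Lemma bil_sym (M : 'M[R]_2) u v : M^T = M -> bil M u v = bil M v u.
Proof.
move=> sM; rewrite /bil -[in LHS]sM -[in RHS]mulmxA -[v in LHS]trmxK.
by rewrite -!trmx_mul mxE.
Qed.

Lemma strain_sym a : (strain a)^T = strain a.
Proof. by apply/matrixP => i j; rewrite !mxE addrC. Qed.

Lemma sym_unit_sym i j : (sym_unit R i j)^T = sym_unit R i j.
Proof. by rewrite /sym_unit linearZ linearD /= !trmx_delta addrC. Qed.

(** Rewrite rules toward the six independent components, after which energy identities are
    polynomial and fall to [field]. *)
Lemma elastic_canonical T : elastic_symmetric T ->
  ((forall k l, T 1 0 k l = T 0 1 k l) * (forall i j, T i j 1 0 = T i j 0 1) *
   (T 0 1 0 0 = T 0 0 0 1) * (T 1 1 0 0 = T 0 0 1 1) *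
   (T 1 1 0 1 = T 0 1 1 1))%type.
Proof.
move=> sT; do !split; [move=> k l|move=> i j|..].
- by case: (sT 1 0 k l).
- by case: (sT i j 1 0).
- by case: (sT 0 1 0 0).
- by case: (sT 1 1 0 0).
- by case: (sT 1 1 0 1).
Qed.

Lemma mat1_sym T : elastic_symmetric T -> (mat1 T)^T = mat1 T.
Proof.
by move=> sT; apply/matrixP => i j; rewrite !mxE; case: (sT j 0 i 0).
Qed.


(** Major symmetry merges the two cross terms, and minor symmetry lets [strain a] be replaced by
    [a (x) e_1] in each contraction. *)
Lemma quad_strain T xi a : elastic_symmetric T ->
  quad T (xi + strain a) =
  quad T xi + 2 * dot a (contract T xi) + bil (mat1 T) a a.
Proof.
move=> sT; have sTE := elastic_canonical sT.
rewrite /quad bilE dotE /contract /contract3 /Defs.sup1.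
rewrite !sum_ord2 !mxE !sum_ord2 !sTE !eqxx /=.
by field.
Qed.

Lemma sub1E T : elastic_symmetric T ->
  sub1 T = fun i j p => Defs.sup1 T p i j.
Proof.
move=> sT; apply/funext => i; apply/funext => j; apply/funext => p.
by rewrite /sub1 /Defs.sup1; case: (sT i j p 0).
Qed.

Lemma quad_sandwich (U : tensor3 R) (P : 'M[R]_2) xi :
  quad (sandwich U P) xi = bil P (contract3 U xi) (contract3 U xi).
Proof.
by rewrite /quad bilE /sandwich /mul33 /mul3m !sum_ord2 !mxE !sum_ord2; ring.
Qed.

Lemma sandwich_symmetric (U : tensor3 R) (P : 'M[R]_2) :
  (forall q k l, U q k l = U q l k) -> P^T = P ->
  elastic_symmetric (sandwich U P).
Proof.
move=> sU sP i j k l; have P10 : P 1 0 = P 0 1 by rewrite -[in LHS]sP mxE.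
rewrite /sandwich /mul33 /mul3m; split.
- by apply: eq_bigr => p _; congr (_ * _); apply: eq_bigr => m _; rewrite sU.
- by apply: eq_bigr => p _; congr (_ * _).
- by rewrite !sum_ord2 P10; ring.
Qed.

Lemma contract3_mulm3 (N : 'M[R]_2) (U : tensor3 R) xi :
  contract3 (mulm3 N U) xi = N *m contract3 U xi.
Proof. by apply/colP => i; rewrite !mxE /mulm3 !sum_ord2 !mxE !sum_ord2; ring. Qed.

Lemma contract_sym_unit T i j k :
  elastic_symmetric T -> contract T (sym_unit R i j) k 0 = T i j k 0.
Proof.
move=> sT; have sTE := elastic_canonical sT.
rewrite /contract /contract3 /Defs.sup1 mxE !sum_ord2 !mxE.
elim/ord2P: i; elim/ord2P: j; elim/ord2P: k;
 rewrite /= ?sTE; by field.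
Qed.

(** Entries become values of a bilinear form, so that positivity of the form can bound them. *)
Lemma sandwich_entry T (N : 'M[R]_2) i j k l : elastic_symmetric T ->
  sandwich (Defs.sup1 T) N i j k l =
  bil N (contract T (sym_unit R i j)) (contract T (sym_unit R k l)).
Proof.
move=> sT; rewrite bilE /sandwich /mul33 /mul3m /Defs.sup1 exchange_big /=.
apply: eq_bigr => p _; rewrite mulr_suml; apply: eq_bigr => m _.
rewrite !contract_sym_unit //; case: (sT k l p 0) => _ _ ->.
by case: (sT i j m 0) => _ _ ->.
Qed.

Lemma bilDl (M : 'M[R]_2) u v w : bil M (u + v) w = bil M u w + bil M v w.
Proof. by rewrite /bil linearD /= !mulmxDl mxE. Qed.

Lemma bilDr (M : 'M[R]_2) u v w : bil M w (u + v) = bil M w u + bil M w v.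
Proof. by rewrite /bil mulmxDr mxE. Qed.

Lemma bilZl (M : 'M[R]_2) t u v : bil M (t *: u) v = t * bil M u v.
Proof. by rewrite /bil linearZ /= -!scalemxAl mxE. Qed.

Lemma bilZr (M : 'M[R]_2) t u v : bil M u (t *: v) = t * bil M u v.
Proof. by rewrite /bil -scalemxAr mxE. Qed.

Lemma bilNl (M : 'M[R]_2) u v : bil M (- u) v = - bil M u v.
Proof. by rewrite -scaleN1r bilZl mulN1r. Qed.

Lemma bilNr (M : 'M[R]_2) u v : bil M u (- v) = - bil M u v.
Proof. by rewrite -scaleN1r bilZr mulN1r. Qed.

Lemma dot_ge0 u : 0 <= dot u u.
Proof. by rewrite dotE; apply: sumr_ge0 => i _; rewrite -expr2 sqr_ge0. Qed.

Lemma dot_gt0 u : u != 0 -> 0 < dot u u.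
Proof.
move=> u0; have [i ui] : exists i, u i 0 != 0.
  apply/(existsP (P := fun i => u i 0 != 0)).
  apply: contraNT u0 => /existsPn h; apply/eqP/colP => i.
  by rewrite [RHS]mxE; apply/eqP; move: (h i); rewrite negbK.
rewrite dotE (bigD1 i) //= ltr_pwDl // -?expr2 ?exprn_even_gt0 //.
by apply: sumr_ge0 => j _; rewrite -expr2 sqr_ge0.
Qed.

Lemma bil_unit (M : 'M[R]_2) :
  (forall a, a != 0 -> 0 < bil M a a) -> M \in unitmx.
Proof.
move=> pM; rewrite unitmxE unitfE; apply/negP => /det0P[v v0 vM].
have /pM : v^T != 0 by apply: contra v0 => /eqP h; rewrite -[v]trmxK h trmx0.
by rewrite /bil trmxK vM mul0mx mxE ltxx.
Qed.

Lemma sqnorm_ge0 xi : 0 <= sqnorm xi.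
Proof. by do 2 (apply: sumr_ge0 => ? _); rewrite sqr_ge0. Qed.

Lemma sqnorm_gt0 xi : xi != 0 -> 0 < sqnorm xi.
Proof.
move=> xi0; rewrite lt_neqAle sqnorm_ge0 andbT eq_sym.
apply: contra xi0 => /eqP/psumr_eq0P h; apply/eqP/matrixP => i j.
have := h (fun k _ => sumr_ge0 _ (fun l _ => sqr_ge0 _)) i isT.
move=> /psumr_eq0P h'; have := h' (fun l _ => sqr_ge0 _) j isT.
by move/eqP; rewrite sqrf_eq0 mxE => /eqP.
Qed.

(** The sides differ by [|strain a|^2 = a_1^2 + a_2^2 / 2]. What is kept is affine in [a], so it
    averages to [|xi|^2] when [a] has mean zero. *)
Lemma sqnorm_strain xi a : xi^T = xi ->
  sqnorm xi + 2 * dot a (col 0 xi) <= sqnorm (xi + strain a).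
Proof.
move=> sxi; have x10 : xi 1 0 = xi 0 1 by rewrite -[in LHS]sxi mxE.
rewrite -subr_ge0 [leRHS](_ : _ = a 0 0 ^+ 2 + a 1 0 ^+ 2 / 2).
  by rewrite addr_ge0 ?sqr_ge0 ?divr_ge0 ?sqr_ge0.
by rewrite /sqnorm dotE !sum_ord2 !mxE /= x10; field.
Qed.

Lemma dot_le_sqnorm_strain a : 2^-1 * dot a a <= sqnorm (strain a).
Proof.
rewrite -subr_ge0 [leRHS](_ : _ = a 0 0 ^+ 2 / 2).
  by rewrite divr_ge0 ?sqr_ge0.
by rewrite /sqnorm dotE !sum_ord2 !mxE /=; field.
Qed.

End Algebra.

(** * Pointwise consequences of coercivity *)

Section Coercive.
Variables (R : realType) (A : R) (T : tensor4 R).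
Hypotheses (A0 : 0 < A) (sT : elastic_symmetric T) (cT : coercive A T).
Let M := mat1 T.
Let N := invmx M.
Implicit Types (xi : 'M[R]_2) (a u v w : 'cV[R]_2).

(** By [quad_strain] at [xi = 0], [bil M a a] is the energy of [strain a] alone; the factor 1/2
    comes from [dot_le_sqnorm_strain]. *)
Lemma mat1_coercive a : A / 2 * dot a a <= bil M a a.
Proof.
have := cT (strain_sym a); rewrite -{2}[strain a]add0r quad_strain //.
have -> : quad T 0 = 0.
  by do 4 (apply: big1 => ? _); rewrite mxE mulr0 mul0r.
have -> : contract T 0 = 0.
  apply/colP => i; rewrite !mxE; do 2 (apply: big1 => ? _).
  by rewrite mxE mulr0.
rewrite /dot mulmx0 mxE mulr0 !add0r -/M; apply: le_trans.
by rewrite -mulrA ler_pM2l // dot_le_sqnorm_strain.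
Qed.

Lemma mat1_posdef a : a != 0 -> 0 < bil M a a.
Proof.
move=> a0; apply: lt_le_trans (mat1_coercive a).
by rewrite mulr_gt0 ?divr_gt0 ?dot_gt0.
Qed.

Lemma mat1_unit : M \in unitmx.
Proof. exact: bil_unit mat1_posdef. Qed.

Lemma inv_mat1_sym : N^T = N.
Proof. by rewrite /N trmx_inv mat1_sym. Qed.

Lemma bil_mat1_inv u v : bil M (N *m u) v = dot u v.
Proof.
rewrite /bil trmx_mul inv_mat1_sym -!mulmxA (mulmxA N) mulVmx ?mat1_unit //.
by rewrite mul1mx.
Qed.

Lemma dot_inv u v : dot u (N *m v) = bil N u v.
Proof. by rewrite /dot mulmxA. Qed.

Lemma bil_inv_ge0 u : 0 <= bil N u u.
Proof.
rewrite -dot_inv -bil_mat1_inv; apply: le_trans (mat1_coercive _).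
by rewrite mulr_ge0 ?dot_ge0 ?divr_ge0 ?ltW.
Qed.

(** Coercivity of [M] at the column [N e_j] reads [A / 2 * |N e_j|^2 <= N j j]. The diagonal entry
    alone gives [N j j <= 2 / A], and then the whole column obeys the same bound. *)
Lemma inv_mat1_le i j : `|N i j| <= 2 / A.
Proof.
have := mat1_coercive (N *m delta_mx j 0).
rewrite bil_mat1_inv -colE /dot trmx_delta -rowE !mxE sum_ord2 !mxE => h.
have h2 k : A / 2 * N k j ^+ 2 <= N j j.
  apply: le_trans h; rewrite ler_pM2l ?divr_gt0 //.
  by elim/ord2P: k; rewrite ?lerDl ?lerDr -expr2 sqr_ge0.
have Njj0 : 0 <= N j j.
  by apply: le_trans (h2 j); rewrite mulr_ge0 ?sqr_ge0 ?divr_ge0 ?ltW.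
have Njj : N j j <= 2 / A.
  have := h2 j; rewrite le_eqVlt in Njj0; case/orP: Njj0 => [/eqP <-|Njj0].
    by rewrite divr_ge0 ?(ltW A0).
  rewrite expr2 mulrA ger_pMl // => h3.
  by rewrite -[2 / A]invf_div -[leRHS]mul1r ler_pdivlMr ?divr_gt0 // mulrC.
rewrite -ler_sqr ?nnegrE ?normr_ge0 ?divr_ge0 ?(ltW A0) //.
rewrite -normrX ger0_norm ?sqr_ge0 // -(ler_pM2l (divr_gt0 A0 (ltr0n _ 2))).
apply: le_trans (h2 i) _; apply: le_trans Njj _.
by rewrite le_eqVlt; apply/orP; left; apply/eqP; field; rewrite gt_eqF.
Qed.

(** Positivity at [u + v] and [u - v]. The bound is a sum rather than a product, so its average
    exists as soon as those of its terms do. *)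
Lemma bil_inv_le u v : `|bil N u v| <= (bil N u u + bil N v v) / 2.
Proof.
have := bil_inv_ge0 (u + v); have := bil_inv_ge0 (u - v).
rewrite !bilDl !bilDr !bilNl !bilNr (bil_sym v u inv_mat1_sym) => h1 h2.
by rewrite ler_norml; apply/andP; split; lra.
Qed.

(* Expand [0 <= (N a - t a) . M (N a - t a)]. *)
Lemma bil_inv_young a t :
  2 * t * dot a a - t ^+ 2 * bil M a a <= bil N a a.
Proof.
have h : 0 <= bil M (N *m a - t *: a) (N *m a - t *: a).
  apply: le_trans (mat1_coercive _).
  by rewrite mulr_ge0 ?dot_ge0 ?divr_ge0 ?ltW.
move: h; rewrite !bilDl !bilDr !bilNl !bilNr !bilZl !bilZr.
rewrite (bil_sym a (N *m a) (mat1_sym sT)) !bil_mat1_inv dot_inv => h.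
by rewrite -subr_ge0; move: h; congr (0 <= _); ring.
Qed.

(** The amplitude [a = N (w - v)] brings the traction from [v] to [w], and
    [2 a . v + a . M a = (w - v) . N (w + v)]. *)
Lemma quad_strain_inv xi w (v := contract T xi) :
  quad T (xi + strain (N *m (w - v))) = quad T xi + bil N w w - bil N v v.
Proof.
rewrite quad_strain // -/M -/v bil_mat1_inv dot_inv.
rewrite [dot _ v](_ : _ = bil N (w - v) v); last first.
  by rewrite /dot /bil trmx_mul inv_mat1_sym.
rewrite !bilDl !bilDr !bilNl !bilNr (bil_sym v w inv_mat1_sym); ring.
Qed.

Lemma quad_strain_inv_ge xi w (v := contract T xi) : xi^T = xi ->
  A * (sqnorm xi + 2 * dot (N *m (w - v)) (col 0 xi)) <=
  quad T xi + bil N w w - bil N v v.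
Proof.
move=> sxi; rewrite -quad_strain_inv -/v.
apply: le_trans (cT _); last by rewrite linearD /= sxi strain_sym.
by rewrite ler_pM2l // sqnorm_strain.
Qed.

(** Relaxing the traction to [w = 0] leaves the energy of a symmetric strain, which is
    nonnegative. *)
Lemma bil_inv_contract_le xi (v := contract T xi) :
  xi^T = xi -> bil N v v <= quad T xi.
Proof.
move=> sxi; rewrite -subr_ge0.
have -> : quad T xi - bil N v v = quad T (xi + strain (N *m (0 - v))).
  rewrite quad_strain_inv -/v; congr (_ - _).
  by rewrite /bil mulmx0 mxE addr0.
apply: le_trans (cT _); last by rewrite linearD /= sxi strain_sym.
by rewrite mulr_ge0 ?sqnorm_ge0 ?ltW.
Qed.

Lemma sandwich_entry_le i j k l :
  `|sandwich (Defs.sup1 T) N i j k l| <=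
  (quad T (sym_unit R i j) + quad T (sym_unit R k l)) / 2.
Proof.
rewrite sandwich_entry //; apply: le_trans (bil_inv_le _ _) _.
by rewrite ler_pM2r // lerD // bil_inv_contract_le // sym_unit_sym.
Qed.

End Coercive.

(** * Calculus of averages, and measurability of the matrix inverse *)

Section Averages.
Variables (R : realType) (l1 : R).
Hypothesis l1_gt0 : 0 < l1.
Let mu := @lebesgue_measure R.
Implicit Types (f g : R -> R) (m n c : R).

(** Integrability travels with the value, because linearity and monotonicity of the integral are
    applied to integrable functions only. *)
Definition has_avg f m :=
  mu.-integrable `[0, l1] (EFin \o f) /\ avg l1 f = m.

Lemma has_avgI f : mu.-integrable `[0, l1] (EFin \o f) -> has_avg f (avg l1 f).
Proof. by []. Qed.

Lemma has_avgD f g m n :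
  has_avg f m -> has_avg g n -> has_avg (fun y => f y + g y) (m + n).
Proof.
move=> [fi <-] [gi <-]; split; first exact: (integrableD _ fi gi).
by rewrite /avg RintegralD // mulrDr.
Qed.

Lemma has_avgZ c f m : has_avg f m -> has_avg (fun y => c * f y) (c * m).
Proof.
move=> [fi <-]; split; first exact: (integrableZl _ c fi).
by rewrite /avg RintegralZl // mulrCA.
Qed.

Lemma has_avgZr c f m : has_avg f m -> has_avg (fun y => f y * c) (m * c).
Proof.
by move=> /(has_avgZ c); rewrite mulrC; under eq_fun do rewrite mulrC.
Qed.

Lemma has_avgB f g m n :
  has_avg f m -> has_avg g n -> has_avg (fun y => f y - g y) (m - n).
Proof.
move=> fm /(has_avgZ (- 1)) gn; rewrite -mulN1r.
by under eq_fun do rewrite -mulN1r; exact: has_avgD.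
Qed.

Lemma has_avg_cst c : has_avg (fun=> c) c.
Proof.
have muE : mu `[0, l1] = l1%:E.
  by rewrite /mu lebesgue_measure_itv /= lte_fin l1_gt0 oppr0 adde0.
split.
  apply: measurable_bounded_integrable => //.
    by rewrite [X in (X < _)%E]muE ltry.
  exists `|c|; split; first exact: num_real.
  by move=> x /ltW cx y _.
by rewrite /avg Rintegral_cst // [X in fine X]muE /= mulrCA mulVf ?gt_eqF ?mulr1.
Qed.

Lemma has_avg_sum (F : 'I_2 -> R -> R) (m : 'I_2 -> R) :
  (forall i, has_avg (F i) (m i)) ->
  has_avg (fun y => \sum_(i < 2) F i y) (\sum_(i < 2) m i).
Proof.
move=> Fm; rewrite sum_ord2; under eq_fun do rewrite sum_ord2.
exact: has_avgD.
Qed.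

Lemma le_has_avg f g m n :
  has_avg f m -> has_avg g n -> (forall y, f y <= g y) -> m <= n.
Proof.
move=> [fi <-] [gi <-] fg; rewrite ler_pM2l ?invr_gt0 //.
by apply: le_Rintegral => // y _; exact: fg.
Qed.

Lemma measurable_inv (D : set R) f :
  measurable_fun D f -> measurable_fun D (fun y => (f y)^-1).
Proof.
(* The identity also holds at zeros of [f], where [0^-1 = 0]; it leaves a real power of a
   nonnegative base, which is measurable. *)
have -> : (fun y => (f y)^-1) = (fun y => f y * (f y ^+ 2) `^ (- 1)).
  apply/funext => y; rewrite powR_inv1 ?sqr_ge0 // expr2.
  have [->|fy0] := eqVneq (f y) 0; first by rewrite invr0 mul0r.
  by rewrite invfM mulrA divff // mul1r.
move=> mf; apply: measurable_funM => //.
apply: (measurableT_comp (measurable_powR (-1))).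
exact: measurable_funX.
Qed.

(** Cramer's rule: cofactors are entries up to sign, and invertibility at every point rules out the
    default branch of [invmx]. *)
Lemma measurable_invmx (D : set R) (M : R -> 'M[R]_2) :
  (forall y, M y \in unitmx) ->
  (forall i j, measurable_fun D (fun y => M y i j)) ->
  forall i j, measurable_fun D (fun y => invmx (M y) i j).
Proof.
move=> uM mM i j.
have mcof p q : measurable_fun D (fun y => cofactor (M y) p q).
  rewrite /cofactor; apply: measurable_funM => //.
  by under eq_fun do rewrite det_mx11 !mxE; exact: mM.
under eq_fun do rewrite /invmx uM !mxE.
apply: measurable_funM => //; apply: measurable_inv.
under eq_fun do rewrite (expand_det_row _ 0).
by apply: measurable_sum => p; exact: measurable_funM.
Qed.

End Averages.

(** * Existence of the averages in the homogenized tensor *)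

Section Homogenized.
Variables (R : realType) (l1 A : R) (C : R -> tensor4 R).
Hypotheses (l1_gt0 : 0 < l1) (A_gt0 : 0 < A).
Let mu := @lebesgue_measure R.
Hypotheses
  (intC : forall i j k l,
     mu.-integrable `[0, l1] (EFin \o (fun y => C y i j k l)))
  (symC : forall y, elastic_symmetric (C y))
  (posC : forall y, coercive A (C y)).

Let N y := invmx (mat1 (C y)).
Let U y := Defs.sup1 (C y).
Let H := avg_mx l1 N.
Let G := avg3 l1 (fun y => mulm3 (N y) (U y)).
Let P := invmx H.

Let N_sym y : (N y)^T = N y.
Proof. exact: inv_mat1_sym (symC y). Qed.

Lemma measurable_entry i j k l :
  measurable_fun `[0, l1] (fun y => C y i j k l).
Proof. by apply/measurable_EFinP; exact: measurable_int (intC i j k l). Qed.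

Lemma measurable_inv_mat1 i j : measurable_fun `[0, l1] (fun y => N y i j).
Proof.
apply: (measurable_invmx (M := fun y => mat1 (C y))) => [y|p q].
  exact: (mat1_unit A_gt0 (symC y) (posC y)).
by under [X in measurable_fun _ X]eq_fun do rewrite mxE; exact: measurable_entry.
Qed.

Lemma has_avg_inv i j : has_avg l1 (fun y => N y i j) (H i j).
Proof.
rewrite mxE; apply: has_avgI.
apply: (le_integrable _ _ _ (has_avg_cst l1_gt0 (2 / A)).1) => //.
  by apply/measurable_EFinP; exact: measurable_inv_mat1.
move=> y _; rewrite lee_fin [leRHS]ger0_norm ?divr_ge0 ?(ltW A_gt0) //.
exact: (inv_mat1_le A_gt0 (symC y) (posC y)).
Qed.

(** As the entries of [N] are bounded by [2 / A], each product is dominated by [2 / A] times an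
    entry of [C]. *)
Lemma has_avg_inv_sup1 q k l :
  has_avg l1 (fun y => mulm3 (N y) (U y) q k l) (G q k l).
Proof.
apply: has_avgI; rewrite /mulm3.
suff h r : has_avg l1 (fun y => N y q r * U y r k l)
    (avg l1 (fun y => N y q r * U y r k l)).
  by case: (has_avg_sum h).
apply: has_avgI.
apply: (le_integrable _ _ _ (has_avgZ (2 / A) (has_avgI (intC r 0 k l))).1) => //.
  apply/measurable_EFinP; apply: measurable_funM.
    exact: measurable_inv_mat1.
  exact: measurable_entry.
move=> y _; rewrite lee_fin /= !normrM ler_wpM2r ?normr_ge0 //.
rewrite -normrM [leRHS]ger0_norm ?divr_ge0 ?(ltW A_gt0) //.
exact: (inv_mat1_le A_gt0 (symC y) (posC y)).
Qed.

Lemma has_avg_quad (F : R -> tensor4 R) (T : tensor4 R) xi :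
  (forall i j k l, has_avg l1 (fun y => F y i j k l) (T i j k l)) ->
  has_avg l1 (fun y => quad (F y) xi) (quad T xi).
Proof.
move=> FT; rewrite /quad; do 4 (apply: has_avg_sum => ?).
by do 2 apply: has_avgZr; exact: FT.
Qed.

Lemma has_avg_bil (F : R -> 'M[R]_2) (M : 'M[R]_2) u v :
  (forall i j, has_avg l1 (fun y => F y i j) (M i j)) ->
  has_avg l1 (fun y => bil (F y) u v) (bil M u v).
Proof.
move=> FM; rewrite bilE; under eq_fun do rewrite bilE.
by do 2 (apply: has_avg_sum => ?); apply: has_avgZr; apply: has_avgZ; exact: FM.
Qed.

Lemma has_avg_dot (F : R -> 'cV[R]_2) (u v : 'cV[R]_2) :
  (forall i, has_avg l1 (fun y => F y i 0) (u i 0)) ->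
  has_avg l1 (fun y => dot (F y) v) (dot u v).
Proof.
move=> Fu; rewrite dotE; under eq_fun do rewrite dotE.
by apply: has_avg_sum => i; apply: has_avgZr; exact: Fu.
Qed.

Lemma has_avg_contract3 (F : R -> tensor3 R) (V : tensor3 R) xi :
  (forall i k l, has_avg l1 (fun y => F y i k l) (V i k l)) ->
  forall i, has_avg l1 (fun y => contract3 (F y) xi i 0) (contract3 V xi i 0).
Proof.
move=> FV i; rewrite mxE; under eq_fun do rewrite mxE.
by do 2 (apply: has_avg_sum => ?); apply: has_avgZr; exact: FV.
Qed.

Lemma has_avg_mulmx (F : R -> 'M[R]_2) (M : 'M[R]_2) (w : 'cV[R]_2) :
  (forall i j, has_avg l1 (fun y => F y i j) (M i j)) ->
  forall i, has_avg l1 (fun y => (F y *m w) i 0) ((M *m w) i 0).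
Proof.
move=> FM i; rewrite mxE; under eq_fun do rewrite mxE.
by apply: has_avg_sum => j; apply: has_avgZr; exact: FM.
Qed.

(** Boundedness of [N] would only dominate by products of two entries of [C], which need not be
    integrable; the energies of the symmetrized units are linear in [C]. *)
Lemma has_avg_sandwich i j k l :
  has_avg l1 (fun y => sandwich (U y) (N y) i j k l)
    (avg4 l1 (fun y => sandwich (U y) (N y)) i j k l).
Proof.
apply: has_avgI.
have avgC xi := has_avg_quad xi (fun i j k l => has_avgI (intC i j k l)).
apply: (le_integrable _ _ _ (has_avgZr 2^-1 (has_avgD (avgC (sym_unit R i j))
  (avgC (sym_unit R k l)))).1) => //.
  apply/measurable_EFinP; rewrite /sandwich /mul33 /mul3m.
  apply: measurable_sum => p; apply: measurable_funM.
    apply: measurable_sum => m; apply: measurable_funM.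
      exact: measurable_entry.
    exact: measurable_inv_mat1.
  exact: measurable_entry.
move=> y _; rewrite lee_fin; apply: le_trans (ler_norm _).
exact: (sandwich_entry_le A_gt0 (symC y) (posC y)).
Qed.

(** * Symmetry and coercivity of the homogenized tensor *)

Lemma avg_inv_sym : H^T = H.
Proof.
apply/matrixP => i j; rewrite !mxE; congr avg; apply/funext => y.
by rewrite -[in RHS]N_sym mxE.
Qed.

(* Averaging [bil_inv_young] with [t] optimal gives [a . H a >= d^2 / m]. *)
Lemma avg_inv_posdef a : a != 0 -> 0 < bil H a a.
Proof.
move=> a0; set d := dot a a; have d0 : 0 < d by exact: dot_gt0.
have avgM : has_avg l1 (fun y => bil (mat1 (C y)) a a)
    (bil (avg_mx l1 (fun y => mat1 (C y))) a a).
  apply: has_avg_bil => i j; rewrite mxE; apply: has_avgI.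
  have -> : (fun y => mat1 (C y) i j) = fun y => C y i 0 j 0.
    by apply/funext => y; rewrite mxE.
  exact: intC.
set m := bil (avg_mx _ _) a a in avgM.
have m0 : 0 < m.
  apply: lt_le_trans (le_has_avg l1_gt0 (has_avg_cst l1_gt0 (A / 2 * d)) avgM _).
    by rewrite mulr_gt0 ?divr_gt0.
  by move=> y; exact: mat1_coercive.
have := le_has_avg l1_gt0 (has_avgB (has_avg_cst l1_gt0 (2 * (d / m) * d))
  (has_avgZ ((d / m) ^+ 2) avgM)) (has_avg_bil a a has_avg_inv).
move=> /(_ (fun y => bil_inv_young A_gt0 (symC y) (posC y) a (d / m))).
apply: lt_le_trans; rewrite [ltRHS](_ : _ = d ^+ 2 / m).
  by rewrite divr_gt0 ?exprn_gt0.
by field; rewrite gt_eqF.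
Qed.

(** By major symmetry of [C] and symmetry of [N], the average of [C_1 N] is the transpose of [G], so
    the last term carries [G] on both sides. *)
Lemma homogenizedE :
  homogenized l1 C = fun i j k l =>
    avg4 l1 C i j k l - avg4 l1 (fun y => sandwich (U y) (N y)) i j k l +
    sandwich G P i j k l.
Proof.
apply/funext => i; apply/funext => j; apply/funext => k; apply/funext => l.
rewrite /homogenized; congr (_ - _ + _).
  by congr avg; apply/funext => y; rewrite sub1E.
rewrite /sandwich /mul33; apply: eq_bigr => p _; congr (_ * _).
rewrite /mul3m; apply: eq_bigr => m _; congr (_ * _).
rewrite /G /avg3; congr avg; apply/funext => y.
rewrite /mulm3 sub1E //; apply: eq_bigr => r _.
by rewrite mulrC -/(N y) -[in LHS]N_sym mxE.
Qed.

Lemma sup1_minor y q k l : U y q k l = U y q l k.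
Proof. by case: (symC y q 0 k l). Qed.

(** Each of the three terms has the symmetries by itself: [G] inherits the minor one from [C], and
    [P] is symmetric because [H] is. *)
Lemma homogenized_symmetric : elastic_symmetric (homogenized l1 C).
Proof.
rewrite homogenizedE => i j k l.
have sG : elastic_symmetric (sandwich G P).
  apply: sandwich_symmetric; last by rewrite /P trmx_inv avg_inv_sym.
  move=> q a b; rewrite /G /avg3; congr avg; apply/funext => y.
  by apply: eq_bigr => r _; rewrite sup1_minor.
have sN y : elastic_symmetric (sandwich (U y) (N y)).
  exact: sandwich_symmetric (sup1_minor y) (N_sym y).
have [G1 G2 G3] := sG i j k l.
split; [rewrite G1|rewrite G2|rewrite G3]; congr (_ - _ + _);
  congr avg; apply/funext => y.
- by case: (symC y i j k l).
- by case: (sN y i j k l).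
- by case: (symC y i j k l).
- by case: (sN y i j k l).
- by case: (symC y i j k l).
- by case: (sN y i j k l).
Qed.

Lemma homogenized_coercive : coercive A (homogenized l1 C).
Proof.
(* Contraction with the constant [xi] commutes with averaging, so [g] is [<N v>]; [w] is the
   traction shared by all layers. *)
move=> xi sxi; set g := contract3 G xi; set w := P *m g.
have uH : H \in unitmx by exact: bil_unit avg_inv_posdef.
have Hw : H *m w = g by rewrite mulmxA mulmxV // mul1mx.
have quadE : quad (homogenized l1 C) xi =
    quad (avg4 l1 C) xi + bil H w w
    - quad (avg4 l1 (fun y => sandwich (U y) (N y))) xi.
  (* Since [H w = g], one has [w . H w = w . g = g . P g], the energy of the last term. *)
  have -> : bil H w w = bil P g g.
    by rewrite {1}/bil -mulmxA Hw /w trmx_mul /P trmx_inv avg_inv_sym.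
  rewrite homogenizedE -quad_sandwich addrAC /quad -sumrB -big_split.
  apply: eq_bigr => i _; rewrite -sumrB -big_split; apply: eq_bigr => j _.
  rewrite -sumrB -big_split; apply: eq_bigr => k _.
  rewrite -sumrB -big_split; apply: eq_bigr => l _.
  by rewrite /= !mulrDl !mulNr.
pose v y := contract (C y) xi.
(* The amplitude [N (w - v)] averages to [H w - g = 0], hence so does its product with a fixed
   vector. *)
have avg0 : has_avg l1 (fun y => dot (N y *m (w - v y)) (col 0 xi)) 0.
  have -> : 0 = dot (0 : 'cV[R]_2) (col 0 xi) by rewrite /dot trmx0 mul0mx mxE.
  apply: has_avg_dot => i.
  have -> : (0 : 'cV[R]_2) i 0 = (H *m w) i 0 - g i 0 by rewrite Hw subrr mxE.
  have -> : (fun y => (N y *m (w - v y)) i 0) =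
      fun y => (N y *m w) i 0 - contract3 (mulm3 (N y) (U y)) xi i 0.
    apply/funext => y; rewrite contract3_mulm3 mulmxBr mxE; congr (_ + _).
    by rewrite mxE.
  apply: has_avgB; first exact: has_avg_mulmx has_avg_inv i.
  exact: has_avg_contract3 has_avg_inv_sup1 i.
have avgL := has_avgZ A (has_avgD (has_avg_cst l1_gt0 (sqnorm xi))
  (has_avgZ 2 avg0)).
have avgR := has_avgB (has_avgD
    (has_avg_quad xi (fun i j k l => has_avgI (intC i j k l)))
    (has_avg_bil w w has_avg_inv)) (has_avg_quad xi has_avg_sandwich).
have := le_has_avg l1_gt0 avgL avgR; rewrite mulr0 addr0 quadE; apply=> y.
(* The sandwich energy at [y] is [v . N v], which leaves the pointwise bound. *)
rewrite quad_sandwich.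
exact: (quad_strain_inv_ge A_gt0 (symC y) (posC y)).
Qed.

End Homogenized.

Unset Implicit Arguments.

Theorem theorem1 (R : realType) (l1 gamma A : R)
    (C CA CB : R -> tensor4 R)
    (hl1 : 0 < l1) (hgamma : 0 < gamma < 1) (hA : 0 < A)
    (hper : forall y : R, C (y + l1) = C y)
    (hCA : forall y : R, 0 < y < gamma * l1 -> C y = CA y)
    (hCB : forall y : R, gamma * l1 < y < l1 -> C y = CB y)
    (hint : forall i j k l : 'I_2,
       (@lebesgue_measure R).-integrable `[0, l1]
         (fun y => (C y i j k l)%:E))
    (hsym : forall y : R, elastic_symmetric (C y))
    (hpos : forall y : R, coercive A (C y)) :
  positive_definite A (homogenized l1 C) /\
  elastic_symmetric (homogenized l1 C).
Proof.
split; last exact: homogenized_symmetric.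
move=> xi sxi xi0; rewrite mulr_gt0 ?sqnorm_gt0 //=.
exact: (homogenized_coercive hl1 hA hint hsym hpos).
Qed.
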